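(* Consider the LPE-BC with COF with $K=2$ users and $Q\ge1$ layers, and assume $\Pr[M\ge q]>0$ and $\mathbb{E}[N_u]>0$ for all $q\in\{1,\dots,Q\}$, $u\in\{1,2\}$. For nonnegative reals $k_{u,q}$ ($u\in\{1,2\}$, $q\in\{1,\dots,Q\}$) define $t^{\rm unc}_q=\frac{k_{1,q}+k_{2,q}}{\Pr[M\ge q]}$, $t^{\rm unc}=\max_{q}t^{\rm unc}_q$, $k^{\rm rem}_{u,q}=k_{u,q}\big(1-\frac{\Pr[N_u\ge q]}{\Pr[M\ge q]}\big)$, $k^{\rm rem}_u=\Big[\sum_{q=1}^{Q}\big(k^{\rm rem}_{u,q}-(t^{\rm unc}-t^{\rm unc}_q)\Pr[N_u\ge q]\big)\Big]^+$, $t^{\rm NC}_u=k^{\rm rem}_u/\mathbb{E}[N_u]$ and $t^{\rm NC}=\max_{u\in\{1,2\}}t^{\rm NC}_u$. Then the region $$\mathcal{C}^{\rm in}=\bigcup_{t>0,\;k_{u,q}\ge0}\Big\{(R_1,R_2):\ t^{\rm unc}+t^{\rm NC}\le t,\ R_u=\tfrac{1}{t}\textstyle\sum_{q=1}^{Q}k_{u,q},\ u\in\{1,2\}\Big\}$$ is achievable, i.e. contained in the capacity region.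
   Context: LPE-BC with COF: fix integers $K$ (users) and $Q$ (layers) and a finite field $\mathcal{X}$. In each slot $t$ the transmitter sends $X_t=(X_{1,t},\dots,X_{Q,t})\in\mathcal{X}^Q$; a random state $N_t=(N_{1,t},\dots,N_{K,t})\in\{0,\dots,Q\}^K$, i.i.d. across slots with arbitrary fixed joint law of $(N_1,\dots,N_K)$, gives user $k$ the output $Y_{k,t}=(X_{1,t},\dots,X_{N_{k,t},t})$ (an erasure symbol if $N_{k,t}=0$). A length-$n$ code with rates $(R_1,\dots,R_K)$ (packets per slot) has independent uniform messages $W_k$ with $|\mathcal{X}|^{nR_k}$ values, encoders $X_t=f_t(W_1,\dots,W_K,N_1,\dots,N_{t-1})$ (feedback), and decoders $\hat W_k=\mathrm{dec}_k(Y_k^n,N_1,\dots,N_n)$; a rate tuple is achievable if error probability $\Pr[\exists k:\hat W_k\ne W_k]\to0$; the capacity region is the convex closure of achievable tuples (the field $\mathcal{X}$ may be taken as large as needed). Notation: $M:=\max(N_1,N_2)$, $[x]^+=\max(0,x)$. *)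

(* Defs.v *)
From HB Require Import structures.
From mathcomp Require Import all_boot all_order all_algebra all_field.
From mathcomp Require Import all_classical all_reals all_analysis.
Set Implicit Arguments. Unset Strict Implicit. Unset Printing Implicit Defensive.
Import Order.TTheory GRing.Theory Num.Theory.
Import numFieldNormedType.Exports.
Local Open Scope ring_scope.
Local Open Scope classical_set_scope.

Section LPEBC.
Variable R : realType.

(* Channel state of one slot for K = 2 users: (N_1, N_2) with N_u in {0,..,Q}. *)
Definition state (Q : nat) : finType := ('I_Q.+1 * 'I_Q.+1)%type.

Definition Nu (Q : nat) (u : 'I_2) (s : state Q) : nat :=
  if val u == 0%N then val s.1 else val s.2.

Definition is_law (Q : nat) (p : {ffun state Q -> R}) : Prop :=
  (forall s, 0 <= p s) /\ \sum_s p s = 1.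

Definition PrM Q (p : {ffun state Q -> R}) (q : nat) : R :=
  \sum_(s | (q <= maxn (val s.1) (val s.2))%N) p s.
Definition PrN Q (p : {ffun state Q -> R}) (u : 'I_2) (q : nat) : R :=
  \sum_(s | (q <= Nu u s)%N) p s.
Definition EN Q (p : {ffun state Q -> R}) (u : 'I_2) : R :=
  \sum_s p s * (Nu u s)%:R.

(* layer i : 'I_Q stands for layer q = i+1;
   X_t : {ffun 'I_Q -> F};  user u sees layers i < N_{u,t}, erasures elsewhere *)
Definition output (F : finFieldType) Q (Nut : nat) (x : {ffun 'I_Q -> F})
  : {ffun 'I_Q -> option F} :=
  [ffun i : 'I_Q => if (val i < Nut)%N then Some (x i) else None].

Definition causal (F : finFieldType) Q n m1 m2
  (enc : 'I_m1 -> 'I_m2 -> 'I_n -> {ffun 'I_n -> state Q} -> {ffun 'I_Q -> F}) : Prop :=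
  forall w1 w2 t (s s' : {ffun 'I_n -> state Q}), (forall i : 'I_n, (val i < val t)%N -> s i = s' i) ->
    enc w1 w2 t s = enc w1 w2 t s'.

Definition received (F : finFieldType) Q n m1 m2
  (enc : 'I_m1 -> 'I_m2 -> 'I_n -> {ffun 'I_n -> state Q} -> {ffun 'I_Q -> F})
  (u : 'I_2) (w1 : 'I_m1) (w2 : 'I_m2) (s : {ffun 'I_n -> state Q})
  : {ffun 'I_n -> {ffun 'I_Q -> option F}} :=
  [ffun t => output (Nu u (s t)) (enc w1 w2 t s)].

Definition err_prob (F : finFieldType) Q (p : {ffun state Q -> R}) n m1 m2
  (enc : 'I_m1 -> 'I_m2 -> 'I_n -> {ffun 'I_n -> state Q} -> {ffun 'I_Q -> F})
  (dec1 : {ffun 'I_n -> {ffun 'I_Q -> option F}} -> {ffun 'I_n -> state Q} -> 'I_m1)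
  (dec2 : {ffun 'I_n -> {ffun 'I_Q -> option F}} -> {ffun 'I_n -> state Q} -> 'I_m2) : R :=
  (m1 * m2)%:R^-1 *
  \sum_(w1 : 'I_m1) \sum_(w2 : 'I_m2) \sum_(s : {ffun 'I_n -> state Q})
     (\prod_(t : 'I_n) p (s t)) *
     ((dec1 (received enc (0 : 'I_2) w1 w2 s) s != w1) ||
      (dec2 (received enc (1 : 'I_2) w1 w2 s) s != w2))%:R.

Definition nmsg (F : finFieldType) (n : nat) (r : R) : nat :=
  absz (Num.ceil (powR (#|F|%:R : R) (n%:R * r))).

Definition achievable_over (F : finFieldType) Q (p : {ffun state Q -> R}) (r1 r2 : R) : Prop :=
  0 <= r1 /\ 0 <= r2 /\
  forall eps : R, 0 < eps -> exists N : nat, forall n : nat, (N <= n)%N ->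
    exists enc : 'I_(nmsg F n r1) -> 'I_(nmsg F n r2) -> 'I_n ->
                 {ffun 'I_n -> state Q} -> {ffun 'I_Q -> F},
    exists dec1, exists dec2,
      causal enc /\ err_prob p enc dec1 dec2 <= eps.

Definition achievable Q (p : {ffun state Q -> R}) (r : R * R) : Prop :=
  exists q0 : nat, forall F : finFieldType, (q0 <= #|F|)%N ->
    achievable_over F p r.1 r.2.

Definition conv_hull (A : set (R * R)) : set (R * R) :=
  [set x | exists n : nat, exists lam : 'I_n -> R, exists pt : 'I_n -> R * R,
     (forall i, 0 <= lam i) /\ \sum_i lam i = 1 /\ (forall i, A (pt i)) /\
     x = (\sum_i lam i * (pt i).1, \sum_i lam i * (pt i).2)].

Definition capacity_region Q (p : {ffun state Q -> R}) : set (R * R) :=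
  @closure (R * R)%type (conv_hull (achievable p)).

Definition t_unc_q Q (p : {ffun state Q -> R}) (k1 k2 : 'I_Q -> R) (i : 'I_Q) : R :=
  (k1 i + k2 i) / PrM p i.+1.
Definition t_unc Q (p : {ffun state Q -> R}) (k1 k2 : 'I_Q -> R) : R :=
  \big[Num.max/0]_(i : 'I_Q) t_unc_q p k1 k2 i.
Definition kk Q (k1 k2 : 'I_Q -> R) (u : 'I_2) : 'I_Q -> R :=
  if val u == 0%N then k1 else k2.
Definition k_rem_q Q (p : {ffun state Q -> R}) (k1 k2 : 'I_Q -> R) (u : 'I_2) (i : 'I_Q) : R :=
  kk k1 k2 u i * (1 - PrN p u i.+1 / PrM p i.+1).
Definition k_rem Q (p : {ffun state Q -> R}) (k1 k2 : 'I_Q -> R) (u : 'I_2) : R :=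
  Num.max 0 (\sum_(i : 'I_Q)
    (k_rem_q p k1 k2 u i - (t_unc p k1 k2 - t_unc_q p k1 k2 i) * PrN p u i.+1)).
Definition t_NC_u Q (p : {ffun state Q -> R}) (k1 k2 : 'I_Q -> R) (u : 'I_2) : R := k_rem p k1 k2 u / EN p u.
Definition t_NC Q (p : {ffun state Q -> R}) (k1 k2 : 'I_Q -> R) : R :=
  Num.max (t_NC_u p k1 k2 0) (t_NC_u p k1 k2 1).

Definition C_in Q (p : {ffun state Q -> R}) : set (R * R) :=
  [set r | exists t : R, exists k1 k2 : 'I_Q -> R,
     0 < t /\ (forall i, 0 <= k1 i) /\ (forall i, 0 <= k2 i) /\
     t_unc p k1 k2 + t_NC p k1 k2 <= t /\
     r.1 = t^-1 * \sum_i k1 i /\ r.2 = t^-1 * \sum_i k2 i].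

End LPEBC.

(* Main.v *)
Require Import Defs.
From HB Require Import structures.
From mathcomp Require Import all_boot all_order all_algebra all_field.
From mathcomp Require Import all_classical all_reals all_analysis.
From mathcomp Require Import zify ring lra.
Import Order.TTheory GRing.Theory Num.Theory.
Import numFieldNormedType.Exports.
Set Implicit Arguments. Unset Strict Implicit. Unset Printing Implicit Defensive.

(** Time is cut into B blocks of L slots. During block b, layer q first carries
    uncoded fresh packets of batch b + 1 for user 1, then for user 2, each packet
    being repeated until one of the users has received it. A packet received only
    by the wrong user is "lost"; that user can cancel it later. For the rest of the
    block, layer q carries sums of one lost packet of batch b for each user:
    working one batch behind makes the list of lost packets available by feedback.
    A user receives in each slot a prefix of the layers, so if the summand meant for
    it is indexed by the number of network-coded symbols it has already received,
    plus the number of network-coded layers below in the slot, then it receives the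
    lost packets consecutively, without gaps and over any field. Decoding thus
    succeeds as soon as the counts of the relevant states are large enough, which
    Chebyshev's inequality gives with high probability once the rates are scaled by
    1 - eta. Letting eta tend to 0 uses the closure in the capacity region. *)

(** * Counting indices and inverting partial sums *)

Section Counting.
Local Open Scope nat_scope.

(** Inverts a running total, to locate the slot that handles item [j]. *)
Lemma sum_crossing (c : nat -> nat) n j : j < \sum_(i < n) c i ->
  exists2 t, t < n & \sum_(i < t) c i <= j < \sum_(i < t) c i + c t.
Proof.
elim: n => [|n IHn]; first by rewrite big_ord0.
rewrite big_ord_recr /= => lt_j.
case: (ltnP j (\sum_(i < n) c i)) => [/IHn[t lt_tn Ht]|le_j].
  by exists t => //; apply: ltnW.
by exists n => //; rewrite le_j.
Qed.

Lemma sum_bool_crossing (a : pred nat) n j : j < \sum_(i < n) a i ->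
  exists t, [/\ t < n, a t & \sum_(i < t) a i = j].
Proof.
move=> /(@sum_crossing (fun i => nat_of_bool (a i)))[t lt_tn /andP[le1 lt2]].
exists t; case: (a t) lt2 => lt2; split => //; lia.
Qed.

Lemma sum_ord_interval n lo hi : lo <= hi -> hi <= n ->
  \sum_(i < n) (lo <= i < hi) = hi - lo.
Proof.
move=> le_lh le_hn.
suff: \sum_(i < n) (lo <= i < hi) = minn n hi - minn n lo by lia.
elim: n {le_hn} => [|n IHn]; first by rewrite big_ord0 !min0n.
rewrite big_ord_recr /= IHn; lia.
Qed.

Lemma sum_ord_block n L b lo hi : lo <= hi -> hi <= L -> b.+1 * L <= n ->
  \sum_(t < n) ((t %/ L == b) && (lo <= t %% L < hi)) = hi - lo.
Proof.
move=> le_lh le_hL le_n; have [L0|L_gt0] := posnP L.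
  rewrite big1; first lia.
  by move=> t _; case: (t %/ L == b) => //=; lia.
have -> : hi - lo = (b * L + hi) - (b * L + lo) by lia.
rewrite -(@sum_ord_interval n); [|lia|lia].
apply: eq_bigr => t _; congr nat_of_bool.
apply/idP/idP => [/andP[/eqP Eb]|].
  by have := divn_eq t L; rewrite Eb; lia.
move=> Ht; have -> : t %/ L = b.
  by apply/eqP; rewrite eqn_leq leq_divRL // -ltnS ltn_divLR //; lia.
rewrite eqxx /=.
have -> : t %% L = t - b * L.
  rewrite -[X in X %% L](@subnKC (b * L)); last by lia.
  by rewrite modnMDl modn_small; lia.
lia.
Qed.
End Counting.

(** * The deterministic coding scheme and its decodability *)

Section Scheme.
Local Open Scope nat_scope.
Variables (F : zmodType) (Q : nat).
(* [lab t q = (b, Some u)]: in slot t, layer q is reserved for the fresh packets of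
   user u in batch b; [(b, None)]: for sums of lost packets of batch b. Users are
   booleans, layers count from 0, [kap b u q] is the size of the batch, and
   [N u t] is the number of layers that user u receives in slot t. *)
Variables (lab : nat -> nat -> nat * option bool) (kap : nat -> bool -> nat -> nat).
Implicit Types (N : bool -> nat -> nat) (W : bool -> nat -> nat -> nat -> F).
Implicit Types (b t q : nat) (u : bool).

Definition rcv N u t q := q < N u t.
Definition hit N t q := q < maxn (N false t) (N true t).
(* Index of the fresh packet sent: it moves on when some user receives it. *)
Definition fptr N t q := \sum_(i < t) ((lab i q == lab t q) && hit N i q).
(** The last conjunct leaves out the zero padding sent once the batch is exhausted. *)
Definition lost N b u t q :=
  [&& lab t q == (b, Some u), hit N t q, ~~ rcv N u t q & fptr N t q < kap b u q].
Definition lostq N b u t : seq (nat * nat) :=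
  [seq x <- [seq (i, q) | i <- iota 0 t, q <- iota 0 Q] | lost N b u x.1 x.2].
Definition ncrcv N b u t := \sum_(q < Q) ((lab t q == (b, None)) && rcv N u t q).
(* Counts the layers below q without regard to reception, which the encoder does not
   know yet; if u receives layer q, it receives all of these. *)
Definition nptr N b u t q :=
  \sum_(i < t) ncrcv N b u i + \sum_(j < q) (lab t j == (b, None)).
Definition pkt N W b u (x : nat * nat) := W u b x.2 (fptr N x.1 x.2).
(* [nth] yields 0 when the list of lost packets is exhausted. *)
Definition coded N W b u t q :=
  nth 0%R [seq pkt N W b u x | x <- lostq N b u t] (nptr N b u t q).
Definition tx N W t q : F :=
  match lab t q with
  | (b, Some u) => if fptr N t q < kap b u q then W u b q (fptr N t q) else 0%R
  | (b, None) => (coded N W b false t q + coded N W b true t q)%R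
  end.

Lemma hitE N u t q : hit N t q = rcv N u t q || rcv N (~~ u) t q.
Proof. by rewrite /hit /rcv leq_max; case: u => //=; rewrite orbC. Qed.

Lemma count_pairs_iota (a : pred (nat * nat)) m n :
  count a [seq (i, j) | i <- iota 0 m, j <- iota 0 n] =
  \sum_(i < m) \sum_(j < n) a (i : nat, j : nat).
Proof.
rewrite -sum1_count big_mkcond big_allpairs_dep /=.
rewrite -{1}[m]subn0 -[iota 0 _]/(index_iota 0 m) big_mkord.
apply: eq_bigr => i _; rewrite -{1}[n]subn0 -[iota 0 _]/(index_iota 0 n) big_mkord.
by apply: eq_bigr => j _; case: (a _).
Qed.

Lemma mem_lostq N b u t x :
  x \in lostq N b u t -> [/\ x.1 < t, x.2 < Q & lost N b u x.1 x.2].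
Proof.
rewrite mem_filter => /andP[Hx /allpairsP[[i j] /= [Hi Hj Ex]]].
move: Hi Hj; rewrite !mem_iota !add0n => /= Hi Hj.
by rewrite Ex /= in Hx *.
Qed.

Lemma eq_fptr N N' t q : (forall u i, i < t -> N u i = N' u i) ->
  fptr N t q = fptr N' t q.
Proof.
move=> eqN; apply: eq_bigr => i _.
by rewrite /hit !eqN.
Qed.

Lemma eq_lostq N N' b u t : (forall v i, i < t -> N v i = N' v i) ->
  lostq N b u t = lostq N' b u t.
Proof.
move=> eqN; apply: eq_in_filter => _ /allpairsP[[i j] /= [Hi _ ->]] /=.
move: Hi; rewrite mem_iota add0n /= => lt_it.
rewrite /lost /hit /rcv !eqN // (@eq_fptr N N') // => v k lt_ki.
exact/eqN/(ltn_trans lt_ki).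
Qed.

(** This is causality: the pointers and lists consult states of earlier slots only, and the part of
    [nptr] within slot [t] depends on labels alone. *)
Lemma eq_tx N N' W t q : (forall v i, i < t -> N v i = N' v i) ->
  tx N W t q = tx N' W t q.
Proof.
move=> eqN; have eqc b u : coded N W b u t q = coded N' W b u t q.
  rewrite /coded (eq_lostq _ _ eqN); congr nth.
    apply/eq_in_map => x /mem_lostq[lt_xt _ _].
    rewrite /pkt (@eq_fptr N N') // => v k lt_kx.
    exact/eqN/(ltn_trans lt_kx).
  congr addn; apply: eq_bigr => i _; apply: eq_bigr => j _.
  by rewrite /rcv eqN.
rewrite /tx; case: (lab t q) => b [u|]; last by rewrite !eqc.
by rewrite (eq_fptr _ eqN).
Qed.

Hypothesis lab_order : forall b u t q i j,
  lab i j = (b, Some u) -> lab t q = (b, None) -> i < t.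

(** All fresh slots of batch [b] are over by its first coded slot, so the list is final there and
    positions in it are stable. *)
Lemma lostq_full N b u t q n : lab t q = (b, None) -> t <= n ->
  lostq N b u n = lostq N b u t.
Proof.
move=> lab_tq le_tn; rewrite /lostq -[in LHS](subnKC le_tn) iotaD.
rewrite map_cat flatten_cat filter_cat -[RHS]cats0; congr (_ ++ _).
apply/eqP; rewrite -[_ == _]negbK -has_filter -all_predC; apply/allP => x.
case/allpairsP => -[i j] /= [Hi _ ->] /=; apply/negP => /and4P[/eqP lab_ij _ _ _].
move: Hi; rewrite mem_iota add0n => /andP[le_ti _].
by have := lab_order lab_ij lab_tq; rewrite ltnNge le_ti.
Qed.

(** Decodability is put as injectivity, so no decoder is built here. Packet [j] leaves the pointer
    in some slot [t]. If [u] did not receive it there, it has a position [m] in the lost list, and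
    the coded symbol that [u] receives with index [m] carries it. *)
Lemma decodable n N W W' u b :
  (forall t q, t < n -> q < Q -> rcv N u t q -> tx N W t q = tx N W' t q) ->
  (forall q, q < Q ->
     kap b u q <= \sum_(t < n) ((lab t q == (b, Some u)) && hit N t q)) ->
  size (lostq N b u n) <= \sum_(t < n) ncrcv N b u t ->
  forall q j, q < Q -> j < kap b u q -> W u b q j = W' u b q j.
Proof.
move=> eq_tx hits served q j lt_qQ lt_jk.
have [t [lt_tn /andP[/eqP lab_tq hit_tq] Ej]] := @sum_bool_crossing
  (fun t => (lab t q == (b, Some u)) && hit N t q) _ _ (leq_trans lt_jk (hits _ lt_qQ)).
have {}Ej : fptr N t q = j by rewrite /fptr lab_tq.
have [rcv_tq|nrcv_tq] := boolP (rcv N u t q).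
  by have := eq_tx _ _ lt_tn lt_qQ rcv_tq; rewrite /tx lab_tq Ej lt_jk.
have lost_tq : (t, q) \in lostq N b u n.
  rewrite mem_filter /lost lab_tq eqxx hit_tq nrcv_tq Ej lt_jk /=.
  by apply/allpairsP; exists (t, q); rewrite !mem_iota.
pose m := index (t, q) (lostq N b u n).
have lt_m : m < \sum_(i < n) ncrcv N b u i.
  by apply: leq_trans served; rewrite index_mem.
have [i lt_in /andP[le_m lt_m']] := sum_crossing lt_m.
have lt_r : m - \sum_(k < i) ncrcv N b u k < ncrcv N b u i by lia.
have [k [lt_kQ /andP[/eqP lab_ik rcv_ik] Ek]] := @sum_bool_crossing
  (fun k => (lab i k == (b, None)) && rcv N u i k) _ _ lt_r.
(* Receiving layer [k] implies receiving all layers below, so the count of labels in [nptr] is a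
   count of receptions. *)
have ptr_ik : nptr N b u i k = m.
  rewrite /nptr; set s := (X in _ + X).
  suff -> : s = \sum_(h < k) ((lab i h == (b, None)) && rcv N u i h) by lia.
  apply: eq_bigr => h _; suff -> : rcv N u i h by rewrite andbT.
  exact: ltn_trans (ltn_ord h) rcv_ik.
(* A packet lost by the other user was received by [u], so the interfering summand is known and
   cancels. *)
have eq_coded v : v = ~~ u -> coded N W b v i k = coded N W' b v i k.
  move=> Ev; rewrite /coded; congr nth; apply/eq_in_map => x /mem_lostq.
  case=> lt_xi lt_xQ /and4P[/eqP lab_x hit_x nrcv_x ptr_x].
  have rcv_x : rcv N u x.1 x.2.
    by move: hit_x; rewrite (hitE _ v) (negbTE nrcv_x) Ev negbK.
  by have := eq_tx _ _ (ltn_trans lt_xi lt_in) lt_xQ rcv_x; rewrite /tx lab_x ptr_x.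
have coded_u V : coded N V b u i k = V u b q j.
  rewrite /coded ptr_ik -(lostq_full _ _ lab_ik (ltnW lt_in)).
  by rewrite (nth_map (0, 0)) ?index_mem // nth_index // /pkt /= Ej.
have := eq_tx _ _ lt_in lt_kQ rcv_ik; rewrite /tx lab_ik.
case: u eq_coded coded_u {lab_tq hits served nrcv_tq lost_tq m lt_m le_m lt_m' lt_r
  rcv_ik Ek ptr_ik eq_tx lt_jk} => eq_coded coded_u.
  by rewrite !coded_u eq_coded // => /addrI.
by rewrite !coded_u (eq_coded true) // => /addIr.
Qed.

End Scheme.

(** * Chebyshev's inequality for independent slots *)

Section Concentration.
Local Open Scope ring_scope.
Variables (R : realFieldType) (T : finType) (p : T -> R).
Hypotheses (p_ge0 : forall x, 0 <= p x) (p_sum1 : \sum_x p x = 1).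

Lemma sum_ffun_prod n (h : 'I_n -> T -> R) :
  \sum_(s : {ffun 'I_n -> T}) \prod_i p (s i) * \prod_i h i (s i) =
  \prod_i \sum_x p x * h i x.
Proof.
rewrite bigA_distr_bigA; apply: eq_bigr => s _; rewrite -big_split.
by apply: eq_bigr.
Qed.

Lemma sum_ffun_sqr n (g : 'I_n -> T -> R) :
  (forall i, \sum_x p x * g i x = 0) ->
  \sum_(s : {ffun 'I_n -> T}) \prod_i p (s i) * (\sum_i g i (s i)) ^+ 2 =
  \sum_i \sum_x p x * g i x ^+ 2.
Proof.
(* [h i j] writes [g i * g j] as a product over all coordinates, diagonal included, so that
   independence applies; the off-diagonal terms then vanish by centring. *)
move=> g0; pose h i j k x := (if k == i then g i x else 1) * (if k == j then g j x else 1).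
have hE i j (s : {ffun 'I_n -> T}) : \prod_k h i j k (s k) = g i (s i) * g j (s j).
  by rewrite /h big_split /= -!big_mkcond /= !big_pred1_eq.
have sqrE (s : {ffun 'I_n -> T}) : \prod_i p (s i) * (\sum_i g i (s i)) ^+ 2 =
    \sum_i \sum_j \prod_i p (s i) * \prod_k h i j k (s k).
  rewrite expr2 mulr_suml mulr_sumr; apply: eq_bigr => i _.
  by rewrite !mulr_sumr; apply: eq_bigr => j _; rewrite hE.
rewrite (eq_bigr _ (fun s _ => sqrE s)).
rewrite exchange_big; apply: eq_bigr => i _; rewrite exchange_big /=.
rewrite (eq_bigr _ (fun j _ => sum_ffun_prod (h i j))).
rewrite (bigD1 i)//= [X in _ + X]big1 ?addr0 => [|j j_neqi]; rewrite (bigD1 i)//=.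
  rewrite [X in _ * X]big1 ?mulr1 => [|k k_neqi].
    by apply: eq_bigr => x _; rewrite /h eqxx expr2.
  by rewrite -[RHS]p_sum1; apply: eq_bigr => x _; rewrite /h (negbTE k_neqi) !mulr1.
rewrite (_ : \sum_x _ = 0) ?mul0r // -[RHS](g0 i); apply: eq_bigr => x _.
by rewrite /h eqxx eq_sym (negbTE j_neqi) mulr1.
Qed.

(** Each centred term [g i x] lies in [-1, 1], so the variance of the count is at most [n]. *)
Lemma chebyshev_count n (W : pred 'I_n) (A : pred T) (D : R) : 0 < D ->
  \sum_(s : {ffun 'I_n -> T}) \prod_i p (s i) *
    (D < `|(\sum_i (W i && A (s i)))%N%:R - (\sum_i W i)%N%:R * \sum_(x | A x) p x|)%R%:R
  <= n%:R / D ^+ 2.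
Proof.
move=> D_gt0; set P := \sum_(x | A x) p x.
pose g i x : R := (W i)%:R * ((A x)%:R - P).
have PE : \sum_x p x * (A x)%:R = P.
  by rewrite /P [RHS]big_mkcond; apply: eq_bigr => x _; case: (A x); rewrite ?mulr1 ?mulr0.
have g0 i : \sum_x p x * g i x = 0.
  rewrite (eq_bigr (fun x => (W i)%:R * (p x * (A x)%:R - p x * P))).
    by rewrite -mulr_sumr sumrB PE -mulr_suml p_sum1 mul1r subrr mulr0.
  by move=> x _; rewrite /g; ring.
have P01 : 0 <= P <= 1.
  rewrite sumr_ge0 //= -p_sum1 /P big_mkcond /=; apply: ler_sum => x _.
  by case: ifP.
have devE (s : {ffun 'I_n -> T}) :
    (\sum_i (W i && A (s i)))%N%:R - (\sum_i W i)%N%:R * P = \sum_i g i (s i).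
  rewrite !natr_sum mulr_suml -sumrB; apply: eq_bigr => i _.
  by rewrite /g mulrBr; case: (W i); case: (A _); rewrite /= ?mulr1 ?mulr0.
apply: (@le_trans _ _ (\sum_(s : {ffun 'I_n -> T})
    (\prod_i p (s i) * (\sum_i g i (s i)) ^+ 2) / D ^+ 2)).
  apply: ler_sum => s _; rewrite -mulrA ler_wpM2l ?prodr_ge0 // devE.
  rewrite ler_pdivlMr ?exprn_gt0 //.
  case: (boolP (D < _)%R) => lt_D; last by rewrite mul0r sqr_ge0.
  rewrite mul1r -[leRHS]real_normK ?num_real //.
  by rewrite ler_pXn2r ?nnegrE ?normr_ge0 // ltW.
rewrite -mulr_suml sum_ffun_sqr // ler_wpM2r ?invr_ge0 ?exprn_ge0 ?(ltW D_gt0) //.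
have -> : n%:R = \sum_(i < n) 1 :> R by rewrite sumr_const card_ord.
apply: ler_sum => i _.
rewrite -p_sum1; apply: ler_sum => x _; rewrite -[leRHS]mulr1 ler_wpM2l //.
by rewrite /g; case: (W i); case: (A x) => /=; case/andP: P01 => P0 P1; nra.
Qed.

End Concentration.

(** * The block schedule *)

Section Schedule.
Local Open Scope nat_scope.
Variables (L : nat) (T : bool -> nat -> nat).

(** The successor on fresh labels creates the lag of one batch behind the coded labels. *)
Definition sched t q : nat * option bool :=
  if t %% L < T false q then ((t %/ L).+1, Some false)
  else if t %% L < T false q + T true q then ((t %/ L).+1, Some true)
  else (t %/ L, None).

Lemma sched_order b u t q i j : 0 < L ->
  sched i j = (b, Some u) -> sched t q = (b, None) -> i < t.
Proof.
move=> L_gt0; rewrite /sched => Hi Ht.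
have Ei : (i %/ L).+1 = b by move: Hi; case: ifP => _; [case | case: ifP => _ //; case].
have Et : t %/ L = b by move: Ht; case: ifP => _ //; case: ifP => _ //; case.
rewrite (divn_eq i L) (divn_eq t L) Et -Ei mulSn.
have := ltn_pmod i L_gt0; lia.
Qed.

Definition winlen (k : option bool) q :=
  if k is Some u then T u q else L - (T false q + T true q).

Lemma sum_sched n b k q : 0 < L -> T false q + T true q <= L ->
  b.+2 * L <= n -> \sum_(t < n) (sched t q == (b.+1, k)) = winlen k q.
Proof.
move=> L_gt0 le_TL le_n.
(* [c] is the block containing the window: batch [b.+1] is sent fresh in block [b] and coded in
   block [b.+1]. *)
pose c := if k is Some _ then b else b.+1.
pose lo := match k with Some false => 0 | Some true => T false q
                   | None => T false q + T true q end.
pose hi := match k with Some false => T false q | Some true => T false q + T true q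
                   | None => L end.
have -> : winlen k q = hi - lo by rewrite /winlen /hi /lo; case: (k) => [[]|] /=; lia.
rewrite -(@sum_ord_block n L c lo hi); first last.
- by rewrite /c; case: (k) => [_|] //; apply: leq_trans le_n; rewrite leq_mul2r; lia.
- by rewrite /hi; case: (k) => [[]|]; lia.
- by rewrite /hi /lo; case: (k) => [[]|]; lia.
apply: eq_bigr => t _; congr nat_of_bool.
have := ltn_pmod t L_gt0; rewrite /sched /c /hi /lo.
have optE : ((forall u v : bool, (Some u == Some v) = (u == v)) *
  (forall u : bool, (Some u == None) = false) *
  (forall u : bool, (None == Some u) = false))%type by [].
by case: ifP; [|case: ifP]; case: (k) => [[]|];
  rewrite xpair_eqE /= ?eqSS ?optE ?eqxx /=; lia.
Qed.
End Schedule.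

(** * State sequences with typical counts allow decoding *)

Section GoodStates.
Local Open Scope ring_scope.
Variables (R : realType) (Q : nat) (p : {ffun state Q -> R}).

(* [None] stands for the better of the two users, so that [Pobs p None q] is the
   paper's Pr[M >= q + 1] and [Pobs p (Some u) q] its Pr[N_u >= q + 1]. *)
Definition obs (k : option bool) (x : state Q) : nat :=
  match k with
  | None => maxn x.1 x.2
  | Some u => if u then x.2 else x.1
  end.
Definition Pobs k (q : nat) : R := \sum_(x | (q < obs k x)%N) p x.

(** Fits the states to the scheme, whose slots are natural numbers; past the horizon nothing is
    received. *)
Definition trace n (s : {ffun 'I_n -> state Q}) (u : bool) (t : nat) : nat :=
  if insub t is Some i then obs (Some u) (s i) else 0.

Lemma trace_ord n (s : {ffun 'I_n -> state Q}) u (i : 'I_n) :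
  trace s u i = obs (Some u) (s i).
Proof. by rewrite /trace valK. Qed.

Section OneSchedule.
Variables (n B L : nat) (T K : bool -> nat -> nat).

(* Fresh slots of block b serve batch b + 1, so there is no batch 0 to serve in block 0,
   and batch B is left empty as no block would serve its lost packets. *)
Definition batch_size (b : nat) u q := if (0 < b < B)%N then K u q else 0%N.

Definition deviation (e : 'I_B * option bool * 'I_Q * option bool)
    (s : {ffun 'I_n -> state Q}) : R :=
  let: (b, k, q, k') := e in
  `|(\sum_(i < n) ((sched L T i q == (b : nat, k)) && (q < obs k' (s i))))%N%:R
    - (\sum_(i < n) (sched L T i q == (b : nat, k)))%N%:R * Pobs k' q|.

Hypothesis p_law : is_law p.

(** A union bound: [B] batches, 3 kinds of window, [Q] layers and 3 observers. *)
Lemma prob_deviation D : 0 < D ->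
  \sum_(s : {ffun 'I_n -> state Q}) \prod_t p (s t) *
    (~~ [forall e, deviation e s <= D])%:R <=
  (9 * B * Q)%:R * (n%:R / D ^+ 2).
Proof.
move=> D_gt0; have [p_ge0 p_sum1] := p_law.
apply: (@le_trans _ _ (\sum_(e : 'I_B * option bool * 'I_Q * option bool)
   \sum_(s : {ffun 'I_n -> state Q}) \prod_t p (s t) * (D < deviation e s)%R%:R)).
  rewrite exchange_big /=; apply: ler_sum => s _; rewrite -mulr_sumr.
  rewrite ler_wpM2l ?prodr_ge0 // negb_forall.
  case: existsP => [[e lt_D]|_]; last by rewrite sumr_ge0.
  by rewrite (bigD1 e) //= ltNge lt_D lerDl sumr_ge0.
apply: le_trans (ler_sum _ (_ : forall e, _ -> _ <= n%:R / D ^+ 2)) _.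
  move=> [[[b k] q] k'] _.
  exact: (chebyshev_count p_ge0 p_sum1
    (fun i : 'I_n => sched L T i q == (b : nat, k)) (fun x => (q < obs k' x)%N)).
rewrite sumr_const !card_prod !card_option !card_bool !card_ord.
by rewrite [leRHS]mulr_natl (_ : (B * 3 * Q * 3 = 9 * B * Q)%N) //; lia.
Qed.

(** Each count costs one [D]. Losses cost two, being bounded by a difference of two counts. *)
Lemma states_decodable (F : zmodType) D (s : {ffun 'I_n -> state Q}) :
  (0 < L)%N -> (B * L <= n)%N ->
  (forall q : 'I_Q, T false q + T true q <= L)%N ->
  (forall u (q : 'I_Q), (K u q)%:R + D <= (T u q)%:R * Pobs None q) ->
  (forall u, \sum_(q < Q) ((T u q)%:R * (Pobs None q - Pobs (Some u) q) + D *+ 2) <=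
     \sum_(q < Q) ((L - (T false q + T true q))%N%:R * Pobs (Some u) q - D)) ->
  (forall e, deviation e s <= D) ->
  forall (u : bool) (W W' : bool -> nat -> nat -> nat -> F),
  (forall (t : 'I_n) (q : 'I_Q), (q < obs (Some u) (s t))%N ->
    tx Q (sched L T) batch_size (trace s) W t q =
    tx Q (sched L T) batch_size (trace s) W' t q) ->
  forall b q j, (0 < b < B)%N -> (q < Q)%N -> (j < K u q)%N -> W u b q j = W' u b q j.
Proof.
move=> L_gt0 le_n le_TL delivered served dev u W W' eq_rcv b q j bB lt_q lt_j.
have cntP k (q' : 'I_Q) k' :
    `|(\sum_(i < n) ((sched L T i q' == (b, k)) && (q' < obs k' (s i))))%N%:R -
      (winlen L T k q')%:R * Pobs k' q'| <= D.
  have lt_bB : (b < B)%N by lia.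
  have := dev (Ordinal lt_bB, k, q', k'); rewrite /deviation /=.
  case: b bB lt_bB => [//|b] bB _; rewrite sum_sched //.
  by apply: leq_trans le_n; rewrite leq_mul2r; lia.
have hitE' (i : 'I_n) (q' : nat) : hit (trace s) i q' = (q' < obs None (s i))%N.
  by rewrite /hit !trace_ord.
have rcvE v (i : 'I_n) (q' : nat) : rcv (trace s) v i q' = (q' < obs (Some v) (s i))%N.
  by rewrite /rcv trace_ord.
apply: (@decodable F Q (sched L T) batch_size _ n (trace s) W W' u b) => //.
- by move=> *; apply: sched_order; eassumption.
- move=> t q' lt_t lt_q' rcv_t.
  by apply: (eq_rcv (Ordinal lt_t) (Ordinal lt_q')); rewrite -rcvE.
- move=> q' lt_q'; rewrite /batch_size bB -(ler_nat R).
  have /= := cntP (Some u) (Ordinal lt_q') None.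
  rewrite ler_norml => /andP[lb _]; have := delivered u (Ordinal lt_q').
  rewrite (eq_bigr _ (fun i _ => congr1 (fun a => nat_of_bool (_ && a)) (hitE' i q'))).
  move: lb => /=; lra.
- rewrite size_filter count_pairs_iota /= -(ler_nat R).
  rewrite exchange_big /= [X in _ <= X%:R]exchange_big /=.
  apply: le_trans (le_trans (served u) _); last first.
    rewrite natr_sum; apply: ler_sum => q' _.
    have := cntP None q' (Some u); rewrite ler_norml => /andP[lb _].
    rewrite (eq_bigr _ (fun i _ => congr1 (fun a => nat_of_bool (_ && a)) (rcvE u i q'))).
    move: lb => /=; lra.
  rewrite natr_sum; apply: ler_sum => q' _.
  have := cntP (Some u) q' None; rewrite ler_norml => /andP[_ ub].
  have := cntP (Some u) q' (Some u); rewrite ler_norml => /andP[lb _].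
  (* A loss is a hit without reception, and reception implies a hit, so marginal counts suffice. *)
  suff : ((\sum_(i < n) lost (sched L T) batch_size (trace s) b u i q')%N%:R <=
     (\sum_(i < n) ((sched L T i q' == (b, Some u)) && (q' < obs None (s i))))%N%:R -
     (\sum_(i < n) ((sched L T i q' == (b, Some u)) && (q' < obs (Some u) (s i))))%N%:R :> R).
    move: lb ub => /=; lra.
  rewrite !natr_sum -sumrB; apply: ler_sum => i _.
  rewrite /lost hitE' rcvE; case: (_ == _) => //=; last by rewrite subr0.
  have : (q' < obs (Some u) (s i) -> q' < obs None (s i))%N.
    by rewrite /obs leq_max; case: (u) => ->; rewrite ?orbT.
  case: (q' < obs (Some u) (s i))%N => /= [->//|_]; first by rewrite subrr.
  by rewrite subr0 ler_nat; case: (q' < _)%N => //=; case: (_ < _)%N.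
by rewrite /batch_size bB.
Qed.
End OneSchedule.
End GoodStates.

(** * From the scheme to codes with random states *)

Section Codes.
Local Open Scope ring_scope.

(** Messages are numbered among the arrays supported on the packet slots of the nonempty batches, of
    which there are [B.-1]. *)
Lemma message_embedding (F : finFieldType) B Q (K : nat -> nat) m :
  (m <= #|F| ^ (B.-1 * \sum_(q < Q) K q))%N ->
  exists V : 'I_m -> nat -> nat -> nat -> F, forall w w',
    (forall b q j, (0 < b < B)%N -> (q < Q)%N -> (j < K q)%N ->
       V w b q j = V w' b q j) -> w = w'.
Proof.
(* [M] bounds every [K q], so one finite index type serves all layers. *)
move=> le_m; pose M := (\sum_(q < Q) K q)%N.
pose I := ('I_B * 'I_Q * 'I_M)%type.
pose S := [pred x : I | (0 < x.1.1)%N && (x.2 < K x.1.2)%N].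
have cardS : #|S| = (B.-1 * \sum_(q < Q) K q)%N.
  rewrite -sum1_card.
  rewrite (eq_bigl (fun x : I => (0 < x.1.1) && true && (x.2 < K x.1.2)))%N; last first.
    by move=> x; rewrite andbT.
  rewrite -(pair_big_dep (fun x : 'I_B * 'I_Q => (0 < x.1) && true)%N
    (fun x (j : 'I_M) => j < K x.2)%N (fun _ _ => 1%N)).
  rewrite -(pair_big (fun b : 'I_B => 0 < b)%N xpredT
    (fun _ (q : 'I_Q) => \sum_(j < M | (j < K q)%N) 1%N))%N /=.
  have inner (q : 'I_Q) : (\sum_(j < M | j < K q) 1 = K q)%N.
    rewrite -[RHS]subn0 -(@sum_ord_interval M 0 (K q)) //.
      by rewrite big_mkcond; apply: eq_bigr => j _; case: (_ < _)%N.
    by rewrite /M (bigD1 q) //= leq_addr.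
  rewrite (eq_bigr (fun=> \sum_(q < Q) K q)%N) => [|b _]; last first.
    by apply: eq_bigr => q _; rewrite inner.
  rewrite sum_nat_const; congr muln.
  rewrite -sum1_card big_mkcond /= -subn1.
  case: (posnP B) => [->|B_gt0]; first by rewrite big_ord0.
  rewrite -(@sum_ord_interval B 1 B) //; apply: eq_bigr => b _.
  by rewrite ltn_ord andbT -[_ \in _]/(0 < b)%N; case: (_ < _)%N.
pose A := [pred f : {ffun I -> F} | pffun_on 0 S predT f].
have cardA : (m <= #|A|)%N by rewrite (card_pffun_on 0 S predT) cardS.
pose f w : {ffun I -> F} := enum_val (widen_ord cardA w).
exists (fun w b q j =>
  if (insub b, insub q, insub j) is (Some b', Some q', Some j')
  then f w (b', q', j') else 0) => w w' eqV.
suff /enum_val_inj[] : f w = f w' by move=> /val_inj.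
apply/ffunP => -[[b q] j].
have [xS|xS] := boolP ((b, q, j) \in S); last first.
  have f0 v : f v (b, q, j) = 0.
    have /pffun_onP[+ _] := enum_valP (widen_ord cardA v).
    by move=> /supportP -> //.
  by rewrite !f0.
move: xS; rewrite inE /= => /andP[b_gt0 lt_j].
by have := eqV b q j; rewrite !valK => -> //; rewrite ?b_gt0 ?ltn_ord.
Qed.

Section Decoding.
Variables (R : realType) (F : finFieldType) (Q : nat) (p : {ffun state Q -> R}).
Hypothesis p_law : is_law p.
Variables (n m1 m2 : nat).
Variable (enc : 'I_m1 -> 'I_m2 -> 'I_n -> {ffun 'I_n -> state Q} -> {ffun 'I_Q -> F}).

(** Each decoder picks any message consistent with its output; on good states there is only one. *)
Lemma decoders_exist (good : pred {ffun 'I_n -> state Q}) :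
  (0 < m1)%N -> (0 < m2)%N ->
  (forall s, good s -> forall w1 w2 w1' w2',
     received enc 0 w1 w2 s = received enc 0 w1' w2' s -> w1 = w1') ->
  (forall s, good s -> forall w1 w2 w1' w2',
     received enc 1 w1 w2 s = received enc 1 w1' w2' s -> w2 = w2') ->
  exists dec1 dec2, err_prob p enc dec1 dec2 <=
    \sum_(s : {ffun 'I_n -> state Q}) \prod_t p (s t) * (~~ good s)%:R.
Proof.
move=> m1_gt0 m2_gt0 good1 good2; have [p_ge0 _] := p_law.
pose dec1 y s := odflt (Ordinal m1_gt0)
  [pick w | [exists w2, received enc 0 w w2 s == y]].
pose dec2 y s := odflt (Ordinal m2_gt0)
  [pick w | [exists w1, received enc 1 w1 w s == y]].
have dec1P s w1 w2 : good s -> dec1 (received enc 0 w1 w2 s) s = w1.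
  move=> gs; rewrite /dec1; case: pickP => [w /existsP[w2' /eqP E]|/(_ w1)] /=.
    exact: good1 gs _ _ _ _ E.
  by move/existsP; case; exists w2.
have dec2P s w1 w2 : good s -> dec2 (received enc 1 w1 w2 s) s = w2.
  move=> gs; rewrite /dec2; case: pickP => [w /existsP[w1' /eqP E]|/(_ w2)] /=.
    exact: good2 gs _ _ _ _ E.
  by move/existsP; case; exists w1.
exists dec1, dec2; rewrite /err_prob ler_pdivrMl ?ltr0n ?muln_gt0 ?m1_gt0 //.
set e := (X in _ <= _ * X).
apply: (@le_trans _ _ (\sum_(w1 < m1) \sum_(w2 < m2) e)).
  apply: ler_sum => w1 _; apply: ler_sum => w2 _; apply: ler_sum => s _.
  rewrite ler_wpM2l ?prodr_ge0 // ler_nat.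
  have [gs|//] := boolP (good s); last by case: (_ || _).
  by rewrite dec1P // dec2P // !eqxx.
by rewrite !sumr_const !card_ord -mulrnA [leRHS]mulr_natl [(m1 * m2)%N]mulnC lexx.
Qed.
End Decoding.

Lemma code_exists (R : realType) (F : finFieldType) (Q : nat) (p : {ffun state Q -> R})
    (n B L m1 m2 : nat) (T K : bool -> nat -> nat) (D : R) :
  is_law p -> 0 < D ->
  (0 < m1)%N -> (0 < m2)%N ->
  (m1 <= #|F| ^ (B.-1 * \sum_(q < Q) K false q))%N ->
  (m2 <= #|F| ^ (B.-1 * \sum_(q < Q) K true q))%N ->
  (0 < L)%N -> (B * L <= n)%N ->
  (forall q : 'I_Q, T false q + T true q <= L)%N ->
  (forall u (q : 'I_Q), (K u q)%:R + D <= (T u q)%:R * Pobs p None q) ->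
  (forall u, \sum_(q < Q) ((T u q)%:R * (Pobs p None q - Pobs p (Some u) q) + D *+ 2) <=
     \sum_(q < Q) ((L - (T false q + T true q))%N%:R * Pobs p (Some u) q - D)) ->
  exists enc : 'I_m1 -> 'I_m2 -> 'I_n -> {ffun 'I_n -> state Q} -> {ffun 'I_Q -> F},
  exists dec1, exists dec2, causal enc /\
    err_prob p enc dec1 dec2 <= (9 * B * Q)%:R * (n%:R / D ^+ 2).
Proof.
move=> p_law D_gt0 m1_gt0 m2_gt0 /message_embedding[V1 V1P] /message_embedding[V2 V2P].
move=> L_gt0 le_n le_TL delivered served.
pose W w1 w2 (u : bool) := if u then V2 w2 else V1 w1.
pose enc (w1 : 'I_m1) (w2 : 'I_m2) (t : 'I_n) (s : {ffun 'I_n -> state Q}) :=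
  [ffun q : 'I_Q => tx Q (sched L T) (batch_size B K) (trace s) (W w1 w2) t q].
have enc_causal : causal enc.
  move=> w1 w2 t s s' eq_s; apply/ffunP => q; rewrite !ffunE.
  apply: eq_tx => v i lt_it; have lt_in := ltn_trans lt_it (ltn_ord t).
  by rewrite (trace_ord s v (Ordinal lt_in)) (trace_ord s' v (Ordinal lt_in)) eq_s.
pose good (s : {ffun 'I_n -> state Q}) := [forall e, deviation (B := B) p L T e s <= D].
have rcv_eq s (u : bool) w1 w2 w1' w2' :
    received enc (if u then 1 else 0) w1 w2 s = received enc (if u then 1 else 0) w1' w2' s ->
    forall (t : 'I_n) (q : 'I_Q), (q < obs (Some u) (s t))%N ->
    tx Q (sched L T) (batch_size B K) (trace s) (W w1 w2) t q =
    tx Q (sched L T) (batch_size B K) (trace s) (W w1' w2') t q.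
  move=> E t q lt_q; have := congr1 (fun g : {ffun 'I_n -> {ffun 'I_Q -> option F}} => g t q) E.
  rewrite !ffunE (_ : Nu _ (s t) = obs (Some u) (s t)); last by case: (u).
  by rewrite lt_q => -[].
have [||dec1 [dec2 le_err]] := @decoders_exist R F Q p p_law n m1 m2 enc good m1_gt0 m2_gt0.
- move=> s /forallP gs w1 w2 w1' w2' /(@rcv_eq s false) E; apply: V1P.
  exact: (states_decodable (K := K) L_gt0 le_n le_TL delivered served gs E).
- move=> s /forallP gs w1 w2 w1' w2' /(@rcv_eq s true) E; apply: V2P.
  exact: (states_decodable (K := K) L_gt0 le_n le_TL delivered served gs E).
by exists enc, dec1, dec2; split => //; exact: le_trans le_err (prob_deviation n B L T p_law D_gt0).
Qed.
End Codes.

(** * Rounding, and feasible window and batch sizes *)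

Section Rates.
Local Open Scope ring_scope.
Variable R : realType.

(** The successor makes the value positive, hence also the block count and block length chosen
    below. *)
Definition up (z : R) : nat := (Num.trunc z).+1.

Lemma up_itv z : 0 <= z -> z <= (up z)%:R <= z + 1.
Proof.
by move=> /truncn_itv /andP[lez ltz]; rewrite (ltW ltz) /= /up -natr1 lerD2r.
Qed.

Lemma up_le z n : (up z <= n)%N -> z <= n%:R.
Proof. by move=> le_n; rewrite (le_trans (ltW (truncnS_gt z))) // ler_nat. Qed.

Lemma nmsg_gt0 (F : finFieldType) n (r : R) : (0 < nmsg F n r)%N.
Proof.
have F_gt0 : 0 < #|F|%:R :> R by rewrite ltr0n; apply/card_gt0P; exists 0.
rewrite /nmsg absz_gt0 ceil_neq0; apply/orP; right; exact: powR_gt0.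
Qed.

Lemma nmsg_le (F : finFieldType) n (r : R) k :
  n%:R * r <= k%:R -> (nmsg F n r <= #|F| ^ k)%N.
Proof.
move=> le_k; have F_ge1 : 1 <= #|F|%:R :> R.
  by rewrite ler1n; apply/card_gt0P; exists 0.
rewrite /nmsg -lez_nat abszE ger0_norm; last first.
  by rewrite ceil_ge0 (lt_le_trans _ (powR_ge0 _ _)) // ltrN10.
rewrite ceil_le_int -[leRHS]/((#|F| ^ k)%N%:R) natrX -powR_mulrn; last first.
  exact: le_trans F_ge1.
exact: ler_powR.
Qed.

Section Feasible.
Variables (Q : nat) (P : nat -> R) (p x : bool -> nat -> R).
Variables (d g m D : R) (L : nat).
Hypotheses (d01 : 0 < d < 1) (g_gt0 : 0 < g) (m_gt0 : 0 < m).
Hypothesis P_bounds : forall q, (q < Q)%N -> m <= P q <= 1.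
Hypothesis p_bounds : forall u q, (q < Q)%N -> 0 <= p u q <= P q.
Hypothesis x_ge0 : forall u q, 0 <= x u q.
Hypothesis x_le : forall q, (q < Q)%N -> x false q + x true q <= P q.
Hypothesis x_rem : forall u, \sum_(q < Q) x u q * (1 - p u q / P q) <=
  \sum_(q < Q) (1 - (x false q + x true q) / P q) * p u q.
Hypothesis g_le_d : 3 * g <= d.
Hypothesis g_le_E : forall u, 6 * Q%:R * g <= d * \sum_(q < Q) p u q.
Hypothesis D_def : D = g * m * L%:R / 2.
Hypothesis L_large : 4 <= g * m * L%:R.

(* The excess g over the expected need absorbs the deviations D, and is itself absorbed
   by the d * L * E[N_u] network-coded symbols gained from scaling the packets by 1 - d. *)
Definition slots u q : nat := up (((1 - d) * x u q / P q + g) * L%:R).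
Definition packets u q : nat := up ((1 - d) * x u q * L%:R).

Let d_ge0 : 0 <= 1 - d.
Proof. by case/andP: d01; lra. Qed.

Let P_gt0 q : (q < Q)%N -> 0 < P q.
Proof. by move=> /P_bounds /andP[+ _]; apply: lt_le_trans. Qed.

Lemma slots_itv u q : (q < Q)%N ->
  ((1 - d) * x u q / P q + g) * L%:R <= (slots u q)%:R
    <= ((1 - d) * x u q / P q + g) * L%:R + 1.
Proof.
move=> lt_q; apply: up_itv; apply: mulr_ge0 => //; apply: addr_ge0; last exact: ltW.
by rewrite divr_ge0 ?(ltW (P_gt0 lt_q)) // mulr_ge0.
Qed.

Lemma packets_itv u q :
  (1 - d) * x u q * L%:R <= (packets u q)%:R <= (1 - d) * x u q * L%:R + 1.
Proof. by apply: up_itv; rewrite !mulr_ge0. Qed.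

Let gL_ge4 : (0 < Q)%N -> 4 <= g * L%:R /\ D <= g * L%:R / 2.
Proof.
move=> Q_gt0; have /andP[le_m le_1] := P_bounds Q_gt0.
have m_le1 : m <= 1 by apply: le_trans le_1.
have : g * m * L%:R <= g * L%:R.
  by rewrite -mulrA ler_wpM2l ?(ltW g_gt0) // -[leRHS]mul1r ler_wpM2r.
rewrite D_def; move: L_large; lra.
Qed.

(** The excess and rounding take at most 2gL + 2 <= 3gL <= dL slots, which the factor 1 - d has
    freed. *)
Lemma slots_le q : (q < Q)%N -> (slots false q + slots true q <= L)%N.
Proof.
move=> lt_q; have [gL _] := gL_ge4 (leq_ltn_trans (leq0n _) lt_q).
have P0 := P_gt0 lt_q.
have /andP[_ T0] := slots_itv false lt_q; have /andP[_ T1] := slots_itv true lt_q.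
rewrite -(ler_nat R) natrD.
have : (x false q + x true q) / P q <= 1 by rewrite ler_pdivrMr ?mul1r // x_le.
rewrite mulrDl => le1.
have : (1 - d) * (x false q / P q + x true q / P q) * L%:R <= (1 - d) * 1 * L%:R.
  by rewrite ler_wpM2r // ler_wpM2l.
have : 3 * g * L%:R <= d * L%:R by rewrite ler_wpM2r.
move: T0 T1; rewrite -!mulrA; nra.
Qed.

(** The excess yields at least gmL = 2D receptions, and D >= 2 covers the rounding. *)
Lemma packets_delivered u q : (q < Q)%N ->
  (packets u q)%:R + D <= (slots u q)%:R * P q.
Proof.
move=> lt_q; have P0 := P_gt0 lt_q.
have /andP[T0 _] := slots_itv u lt_q; have /andP[_ K1] := packets_itv u q.
have /andP[le_m _] := P_bounds lt_q.
have : ((1 - d) * x u q / P q + g) * L%:R * P q <= (slots u q)%:R * P q.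
  by rewrite ler_wpM2r // ltW.
have -> : ((1 - d) * x u q / P q + g) * L%:R * P q =
   (1 - d) * x u q * L%:R + g * P q * L%:R by field; rewrite gt_eqF.
have : g * m * L%:R <= g * P q * L%:R by rewrite ler_wpM2r // ler_wpM2l // ltW.
move: L_large; rewrite D_def; lra.
Qed.

(** Rounding and deviations cost at most 3gL per layer on each side; the total 6QgL is paid by
    [g_le_E], and the rest is [x_rem] scaled by 1 - d. *)
Lemma lost_served u :
  \sum_(q < Q) ((slots u q)%:R * (P q - p u q) + D *+ 2) <=
  \sum_(q < Q) ((L - (slots false q + slots true q))%N%:R * p u q - D).
Proof.
have lhs : \sum_(q < Q) ((slots u q)%:R * (P q - p u q) + D *+ 2) <=
    \sum_(q < Q) ((1 - d) * L%:R * (x u q * (1 - p u q / P q)) + (g * L%:R * 3)).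
  apply: ler_sum => -[q lt_q] _ /=; have P0 := P_gt0 lt_q.
  have [gL leD] := gL_ge4 (leq_ltn_trans (leq0n _) lt_q).
  have /andP[p0 pP] := p_bounds u lt_q; have /andP[_ P1] := P_bounds lt_q.
  have /andP[_ T1] := slots_itv u lt_q.
  have : (slots u q)%:R * (P q - p u q) <=
      (((1 - d) * x u q / P q + g) * L%:R + 1) * (P q - p u q).
    by rewrite ler_wpM2r // subr_ge0.
  have -> : (((1 - d) * x u q / P q + g) * L%:R + 1) * (P q - p u q) =
     (1 - d) * L%:R * (x u q * (1 - p u q / P q)) + (g * L%:R + 1) * (P q - p u q).
    by field; rewrite gt_eqF.
  have : (g * L%:R + 1) * (P q - p u q) <= (g * L%:R + 1) * 1.
    by rewrite ler_wpM2l //; lra.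
  rewrite mulr2n; lra.
have rhs : \sum_(q < Q) (L%:R * ((1 - d) * ((1 - (x false q + x true q) / P q) * p u q) +
      d * p u q) - g * L%:R * 3) <=
    \sum_(q < Q) ((L - (slots false q + slots true q))%N%:R * p u q - D).
  apply: ler_sum => -[q lt_q] _ /=; have P0 := P_gt0 lt_q.
  have [gL leD] := gL_ge4 (leq_ltn_trans (leq0n _) lt_q).
  have /andP[p0 pP] := p_bounds u lt_q; have /andP[_ P1] := P_bounds lt_q.
  have /andP[_ T0] := slots_itv false lt_q; have /andP[_ T1] := slots_itv true lt_q.
  rewrite natrB ?slots_le // natrD.
  have : (L%:R - (((1 - d) * x false q / P q + g) * L%:R + 1 +
       (((1 - d) * x true q / P q + g) * L%:R + 1))) * p u q <=
     (L%:R - ((slots false q)%:R + (slots true q)%:R)) * p u q.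
    rewrite ler_wpM2r //; lra.
  have -> : (L%:R - (((1 - d) * x false q / P q + g) * L%:R + 1 +
       (((1 - d) * x true q / P q + g) * L%:R + 1))) * p u q =
     L%:R * ((1 - d) * ((1 - (x false q + x true q) / P q) * p u q) + d * p u q)
     - (g * L%:R + 1) * p u q *+ 2 by field; rewrite gt_eqF.
  have : (g * L%:R + 1) * p u q <= (g * L%:R + 1) * 1 by rewrite ler_wpM2l //; lra.
  rewrite mulr2n; lra.
apply: le_trans lhs (le_trans _ rhs).
rewrite sumrB big_split /= -!mulr_sumr !sumr_const !card_ord big_split /= -!mulr_sumr.
have := x_rem u; set S1 := \sum_(i < Q) _ * _; set S2 := \sum_(i < Q) _ * _ => le_S.
have : (1 - d) * L%:R * S1 <= (1 - d) * L%:R * S2 by rewrite ler_wpM2l // mulr_ge0.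
have : 6 * Q%:R * g * L%:R <= d * (\sum_(i < Q) p u i) * L%:R by rewrite ler_wpM2r.
rewrite -mulr_natr; lra.
Qed.

End Feasible.
End Rates.

(** * Achievability from per-layer rates *)

Section Probabilities.
Local Open Scope ring_scope.
Variables (R : realType) (Q : nat) (p : {ffun state Q -> R}).
Hypothesis p_law : is_law p.

Lemma Pobs_ge0 k q : 0 <= Pobs p k q.
Proof. by apply: sumr_ge0 => s _; case: p_law. Qed.

Lemma le_Pobs k k' q q' :
  (forall s : state Q, (q < obs k s)%N -> (q' < obs k' s)%N) ->
  Pobs p k q <= Pobs p k' q'.
Proof.
move=> le_obs; rewrite /Pobs big_mkcond [leRHS]big_mkcond; apply: ler_sum => s _.
have [p_ge0 _] := p_law; case: ifP => [/le_obs -> //|_]; by case: ifP.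
Qed.

Lemma Pobs_le1 k q : Pobs p k q <= 1.
Proof.
have [p_ge0 <-] := p_law; rewrite /Pobs big_mkcond; apply: ler_sum => s _.
by case: ifP.
Qed.

Lemma PrN_Pobs (u : bool) q : PrN p (if u then 1 else 0) q.+1 = Pobs p (Some u) q.
Proof. by case: u. Qed.

(** The tail-sum formula for an expectation. *)
Lemma EN_Pobs (u : bool) :
  EN p (if u then 1 else 0) = \sum_(q < Q) Pobs p (Some u) q.
Proof.
rewrite /Pobs (eq_bigr (fun q : 'I_Q => \sum_s p s * (q < obs (Some u) s)%N%:R)).
  rewrite exchange_big; apply: eq_bigr => s _ /=.
  rewrite -mulr_sumr -natr_sum; congr (_ * _%:R).
  have -> : Nu (if u then 1 else 0) s = obs (Some u) s by case: (u).
  rewrite -[LHS]subn0 -(@sum_ord_interval Q 0) //.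
  by rewrite /obs -ltnS; case: (u); apply: ltn_ord.
move=> q _; rewrite big_mkcond; apply: eq_bigr => s _.
by case: ifP; rewrite ?mulr1 ?mulr0.
Qed.

(** [x u q] counts packets per slot: the fresh windows fit in a block, and the lost packets fit in
    what remains. With [B] fixed, the Chebyshev bound decays like 1/L. *)
Lemma rates_achievable (x : bool -> nat -> R) eta :
  (0 < Q)%N ->
  (forall q, (q < Q)%N -> 0 < Pobs p None q) ->
  (forall u, 0 < \sum_(q < Q) Pobs p (Some u) q) ->
  (forall u q, 0 <= x u q) ->
  (forall q, (q < Q)%N -> x false q + x true q <= Pobs p None q) ->
  (forall u, \sum_(q < Q) x u q * (1 - Pobs p (Some u) q / Pobs p None q) <=
    \sum_(q < Q) (1 - (x false q + x true q) / Pobs p None q) * Pobs p (Some u) q) ->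
  0 < eta < 1 ->
  achievable p ((1 - eta) * \sum_(q < Q) x false q, (1 - eta) * \sum_(q < Q) x true q).
Proof.
move=> Q_gt0 P_gt0 E_gt0 x_ge0 x_le x_rem /andP[eta_gt0 eta_lt1].
exists 0%N => F _; set r1 := (1 - eta) * _; set r2 := (1 - eta) * _.
have eta_le1 : 0 <= 1 - eta by lra.
split; first by rewrite mulr_ge0 ?sumr_ge0.
split; first by rewrite mulr_ge0 ?sumr_ge0.
move=> eps eps_gt0 /=.
(* Packets are scaled by 1 - d, one block in B serves no batch, and up to B slots are
   left over: each loss costs at most a factor 1 - d, and (1 - d)^3 >= 1 - eta. *)
pose d := eta / 3; have d_gt0 : 0 < d by rewrite /d; lra.
have d_lt1 : d < 1 by rewrite /d; lra.
have d01 : 0 < d < 1 by rewrite d_gt0.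
pose B := up d^-1.
(* The top layer is the least likely to be received, so [m] bounds all layers from below. *)
pose m := Pobs p None Q.-1.
have m_gt0 : 0 < m by apply: P_gt0; rewrite prednK.
pose E u := \sum_(q < Q) Pobs p (Some u) q.
pose g := d * Num.min 1 (Num.min (E false) (E true)) / (6 * Q%:R).
have Q_ge1 : 1 <= Q%:R :> R by rewrite ler1n.
have gE : 6 * Q%:R * g = d * Num.min 1 (Num.min (E false) (E true)).
  by rewrite /g; field; rewrite gt_eqF //; lra.
have g_gt0 : 0 < g.
  by rewrite /g divr_gt0 ?mulr_gt0 ?lt_min ?ltr01 ?E_gt0 //; lra.
have g_le_E u : 6 * Q%:R * g <= d * E u.
  by rewrite gE ler_wpM2l ?(ltW d_gt0) // !ge_min; case: u; rewrite lexx !orbT.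
have g_le_d : 3 * g <= d.
  have : 6 * Q%:R * g <= d * 1 by rewrite gE ler_wpM2l ?(ltW d_gt0) // ge_min lexx.
  have : 6 * 1 * g <= 6 * Q%:R * g by rewrite ler_wpM2r ?(ltW g_gt0) // ler_wpM2l.
  lra.
(* From n <= 2BL and D = gmL/2: the error bound 9BQn/D^2 is at most c/(g^2 m^2 L). *)
pose c : R := 72 * B%:R ^+ 2 * Q%:R.
pose L0 := (up d^-1 + up (4 / (g * m)) + up (c / (eps * g ^+ 2 * m ^+ 2)))%N.
exists (B * L0)%N => n le_n; pose L := (n %/ B)%N.
have le_L0 : (L0 <= L)%N by rewrite leq_divRL // mulnC.
have [Ld Lgm Leps] : [/\ up d^-1 <= L, up (4 / (g * m)) <= L &
    up (c / (eps * g ^+ 2 * m ^+ 2)) <= L]%N.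
  by split; apply: leq_trans le_L0; rewrite /L0 -?addnA ?leq_addr // addnCA ?leq_addr // addnA leq_addl.
have L_d : 1 <= d * L%:R.
  by rewrite mulrC -ler_pdivrMr // div1r; exact: up_le.
have L_gm : 4 <= g * m * L%:R.
  by rewrite mulrC -ler_pdivrMr; [exact: up_le | exact: mulr_gt0].
have L_eps : c <= eps * g ^+ 2 * m ^+ 2 * L%:R.
  rewrite mulrC -ler_pdivrMr; [exact: up_le | apply: mulr_gt0; last exact: exprn_gt0].
  by rewrite mulr_gt0 ?exprn_gt0.
have B_d : 1 <= d * B%:R.
  by rewrite mulrC -ler_pdivrMr // div1r; exact: up_le.
have L_gt0 : (0 < L)%N by apply: leq_trans Ld.
have L_ge1 : 1 <= L%:R :> R by rewrite ler1n.
have n_lt : n%:R <= B%:R * (L%:R + 1) :> R.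
  by rewrite natr1 -natrM ler_nat mulnC ltnW // ltn_ceil.
pose T := slots (Pobs p None) x d g L; pose K := packets x d L.
have rate u : n%:R * ((1 - eta) * \sum_(q < Q) x u q) <=
    (B.-1 * \sum_(q < Q) K u q)%N%:R.
  have le_K : (1 - d) * (\sum_(q < Q) x u q) * L%:R <= (\sum_(q < Q) K u q)%N%:R.
    rewrite natr_sum mulr_sumr mulr_suml; apply: ler_sum => q _.
    by have /andP[] := @packets_itv R x d L d01 x_ge0 u q.
  set X := \sum_(q < Q) _ in le_K *; have X_ge0 : 0 <= X by apply: sumr_ge0.
  rewrite natrM -subn1 natrB //.
  have B1 : (1 - d) * B%:R <= B%:R - 1 by lra.
  have L1 : (1 - d) * (L%:R + 1) <= L%:R by lra.
  apply: le_trans (ler_wpM2l _ le_K); last by rewrite subr_ge0 ler1n.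
  apply: (@le_trans _ _ (B%:R * (L%:R + 1) * ((1 - eta) * X))).
    by rewrite ler_wpM2r // mulr_ge0.
  apply: (@le_trans _ _ ((1 - d) * B%:R * ((1 - d) * X * ((1 - d) * (L%:R + 1))))).
    have -> : (1 - d) * B%:R * ((1 - d) * X * ((1 - d) * (L%:R + 1))) =
      (1 - d) ^+ 3 * (B%:R * (L%:R + 1) * X) by ring.
    have -> : B%:R * (L%:R + 1) * ((1 - eta) * X) =
      (1 - 3 * d) * (B%:R * (L%:R + 1) * X) by rewrite /d; field.
    rewrite ler_wpM2r ?mulr_ge0 ?addr_ge0 //; nra.
  have d1 : 0 <= 1 - d by lra.
  have L1_ge0 : 0 <= L%:R + 1 :> R by rewrite addr_ge0.
  apply: ler_pM => //; [by rewrite mulr_ge0 | by rewrite !mulr_ge0 |].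
  by rewrite ler_wpM2l // mulr_ge0.
have P_bounds q : (q < Q)%N -> m <= Pobs p None q <= 1.
  by move=> lt_q; rewrite Pobs_le1 andbT le_Pobs // => s; apply: leq_ltn_trans; rewrite -ltnS prednK.
have p_bounds u q : (q < Q)%N -> 0 <= Pobs p (Some u) q <= Pobs p None q.
  move=> _; rewrite Pobs_ge0 le_Pobs // => s.
  by rewrite /obs leq_max; case: u => ->; rewrite ?orbT.
pose D := g * m * L%:R / 2.
have D_gt0 : 0 < D by rewrite /D; lra.
have [||||enc [dec1 [dec2 [enc_causal le_err]]]] := @code_exists R F Q p n B L
  (nmsg F n r1) (nmsg F n r2) T K D p_law D_gt0 (nmsg_gt0 _ _ _) (nmsg_gt0 _ _ _)
  (nmsg_le F (rate false)) (nmsg_le F (rate true)) L_gt0.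
- by rewrite mulnC leq_trunc_div.
- by move=> q; apply: (slots_le d01 g_gt0 m_gt0 P_bounds x_ge0 x_le g_le_d erefl L_gm).
- by move=> u q; apply: (packets_delivered d01 g_gt0 m_gt0 P_bounds x_ge0 erefl L_gm).
- exact: (lost_served d01 g_gt0 m_gt0 P_bounds p_bounds x_ge0 x_le x_rem g_le_d
    g_le_E erefl L_gm).
exists enc, dec1, dec2; split => //; apply: le_trans le_err _.
rewrite mulrA ler_pdivrMr ?exprn_gt0 //.
have n_le : n%:R <= 2 * B%:R * L%:R :> R.
  apply: le_trans n_lt _; rewrite -mulrA mulrCA ler_wpM2l //; lra.
apply: (@le_trans _ _ ((9 * B * Q)%N%:R * (2 * B%:R * L%:R))); first by rewrite ler_wpM2l.
have -> : (9 * B * Q)%N%:R * (2 * B%:R * L%:R) = c * L%:R / 4 :> R.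
  by rewrite !natrM /c; field.
have -> : eps * D ^+ 2 = eps * g ^+ 2 * m ^+ 2 * L%:R * L%:R / 4 by rewrite /D; field.
by rewrite ler_wpM2r // ler_wpM2r.
Qed.

End Probabilities.

(** * Passing to the closure, and the inner region *)

Local Open Scope ring_scope.
Local Open Scope classical_set_scope.

Lemma sub_conv_hull {R : realType} (A : set (R * R)) : A `<=` conv_hull A.
Proof.
move=> r Ar; exists 1%N, (fun=> 1), (fun=> r).
rewrite !big_ord1 !mul1r -surjective_pairing; split => // i; exact: ler01.
Qed.

Lemma closure_shrink {R : realType} (A : set (R * R)) (r : R * R) :
  (forall eta, 0 < eta < 1 -> A ((1 - eta) * r.1, (1 - eta) * r.2)) -> @closure (R * R)%type A r.
Proof.
(* [c] bounds both coordinates, so shrinking moves each by at most [eta * c]; the added 1 keeps [c]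
   positive. *)
move=> Ar V /nbhs_ballP[e /= e_gt0 ballV].
pose c := `|r.1| + `|r.2| + 1; pose eta := Num.min 2^-1 (e / (2 * c)).
have c_gt0 : 0 < c by rewrite ltr_wpDl ?addr_ge0.
have eta_gt0 : 0 < eta by rewrite lt_min invr_gt0 ltr0n divr_gt0 // mulr_gt0.
have eta_lt1 : eta < 1 by rewrite gt_min invf_lt1 ?ltr1n.
have eta_c : eta * c < e.
  have : eta * (2 * c) <= e by rewrite -ler_pdivlMr ?mulr_gt0 // ge_min lexx orbT.
  have : 0 < eta * c by rewrite mulr_gt0.
  lra.
have close z : `|z| <= c -> ball z e ((1 - eta) * z).
  move=> le_z; rewrite -ball_normE /=.
  have -> : z - (1 - eta) * z = eta * z by ring.
  rewrite normrM (gtr0_norm eta_gt0); apply: le_lt_trans eta_c.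
  by rewrite ler_wpM2l // ltW.
exists ((1 - eta) * r.1, (1 - eta) * r.2); split; first by apply: Ar; rewrite eta_gt0.
apply: ballV; split; apply: close; rewrite /c.
  by rewrite -addrA lerDl addr_ge0.
by rewrite addrAC lerDr addr_ge0.
Qed.

Lemma PrM_Pobs {R : realType} Q (p : {ffun state Q -> R}) q :
  PrM p q.+1 = Pobs p None q.
Proof. by []. Qed.

Section Region.
Context {R : realType} {Q : nat} {p : {ffun state Q -> R}} {k1 k2 : 'I_Q -> R}.
Hypothesis EN_gt0 : forall u : 'I_2, 0 < EN p u.

Lemma t_unc_ge i : t_unc_q p k1 k2 i <= t_unc p k1 k2.
Proof. by rewrite /t_unc (bigD1 i) //= le_max lexx. Qed.

Lemma t_NC_ge0 : 0 <= t_NC p k1 k2.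
Proof. by rewrite le_max divr_ge0 ?(ltW (EN_gt0 _)) // le_max lexx. Qed.

(** The time left on a layer splits into [t - t_unc], common to all layers and long enough for
    [k_rem], and [t_unc - t_unc_q], already credited inside [k_rem]. *)
Lemma rem_le (u : bool) (t : R) : t_unc p k1 k2 + t_NC p k1 k2 <= t ->
  \sum_i k_rem_q p k1 k2 (if u then 1 else 0) i <=
  \sum_i (t - t_unc_q p k1 k2 i) * Pobs p (Some u) i.
Proof.
move=> le_t; set v : 'I_2 := if u then 1 else 0.
have : k_rem p k1 k2 v <= (t - t_unc p k1 k2) * EN p v.
  rewrite -ler_pdivrMr //; apply: (@le_trans _ _ (t_NC p k1 k2)); last lra.
  by rewrite /t_NC le_max /v; case: (u); rewrite lexx ?orbT.
rewrite ge_max => /andP[_]; rewrite sumrB EN_Pobs mulr_sumr => le_rem.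
rewrite -subr_ge0 -sumrB.
move: le_rem; rewrite lerBlDr -subr_ge0 -big_split -sumrB /=.
congr (_ <= _); apply: eq_bigr => i _; rewrite PrN_Pobs; ring.
Qed.

End Region.

Theorem theorem2 (R : realType) (Q : nat) (p : {ffun state Q -> R}) :
  (0 < Q)%N -> is_law p ->
  (forall q : nat, (1 <= q <= Q)%N -> 0 < PrM p q) ->
  (forall u : 'I_2, 0 < EN p u) ->
  C_in p `<=` capacity_region p.
Proof.
move=> Q_gt0 p_law PrM_gt0 EN_gt0 r [t [k1 [k2 [t_gt0 [k1_ge0 [k2_ge0 [le_t [r1E r2E]]]]]]]].
(* Dividing by [t] turns packet numbers into rates per slot, so that a block has unit length. *)
pose x (u : bool) q : R :=
  if insub q is Some i then t^-1 * kk k1 k2 (if u then 1 else 0) i else 0.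
have xE u (i : 'I_Q) : x u i = t^-1 * kk k1 k2 (if u then 1 else 0) i.
  by rewrite /x valK.
have P_gt0 q : (q < Q)%N -> 0 < Pobs p None q by move=> lt_q; apply: (PrM_gt0 q.+1).
have sumxE (i : 'I_Q) : x false i + x true i = t^-1 * (k1 i + k2 i).
  by rewrite !xE mulrDr.
apply: closure_shrink => eta eta01; apply: sub_conv_hull.
have -> : r.1 = \sum_(q < Q) x false q.
  by rewrite r1E mulr_sumr; apply: eq_bigr => i _; rewrite xE.
have -> : r.2 = \sum_(q < Q) x true q.
  by rewrite r2E mulr_sumr; apply: eq_bigr => i _; rewrite xE.
apply: rates_achievable => //.
- by move=> u; rewrite -EN_Pobs.
- move=> u q; rewrite /x; case: insubP => // i _ _.
  by rewrite mulr_ge0 ?invr_ge0 ?(ltW t_gt0) // /kk; case: ifP.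
- move=> q lt_q; rewrite (sumxE (Ordinal lt_q)) ler_pdivrMl // -ler_pdivrMr ?P_gt0 //.
  apply: (le_trans (t_unc_ge (Ordinal lt_q))); apply: le_trans le_t.
  by rewrite lerDl t_NC_ge0.
move=> u; have := rem_le EN_gt0 u le_t.
rewrite -(ler_pM2l (x := t^-1)) ?invr_gt0 // !mulr_sumr.
congr (_ <= _); apply: eq_bigr => i _.
  by rewrite /k_rem_q PrN_Pobs PrM_Pobs xE mulrA.
rewrite mulrA sumxE /t_unc_q PrM_Pobs; congr (_ * _).
by rewrite mulrBr mulVf ?gt_eqF // mulrA.
Qed.
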